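(* Let $N\ge1$, $\alpha\in(0,1)$, and consider the system $\boldsymbol{x}_{k+1}=A\boldsymbol{x}_k+B\boldsymbol{u}_k+D\boldsymbol{\delta}_k$ with deterministic initial state $\boldsymbol{x}_0\in\mathbb{R}^{n_x}$, deterministic inputs $\boldsymbol{u}=(\boldsymbol{u}_0,\dots,\boldsymbol{u}_{N-1})$, and i.i.d. noise $\boldsymbol{\delta}_k$ drawn from a discrete distribution with $J$ outcomes and probability mass function $(p(1),\dots,p(J))$. Let the stage cost be quadratic, $c(\boldsymbol{x}_k,\boldsymbol{u}_k)=\boldsymbol{x}_k^TQ\boldsymbol{x}_k+\boldsymbol{u}_k^TR\boldsymbol{u}_k$, with $Q,R$ symmetric positive semidefinite. Then the cost $$\mathcal{J}(\boldsymbol{x}_0,\boldsymbol{u})=\mathrm{TVD}_{1-\alpha}\Big(\sum_{k=0}^{N-1}c(\boldsymbol{x}_k,\boldsymbol{u}_k)\Big)$$ is equal to $$\min_{m\in\mathbb{R},\,z\in\mathbb{R},\,\boldsymbol{s}\in\mathbb{R}^{J^N}}\ \sum_{k=0}^{N-1}c(\tilde{\boldsymbol{x}}_k,\boldsymbol{u}_k)+\alpha m+(1-\alpha)\sum_{j=1}^{J^N}p_N(j)\Big(z+\frac{s(j)}{1-\alpha}\Big)$$ subject to, for all $j\in\{1,\dots,J^N\}$, $$m\ge\sum_{k=0}^{N-1}\big(\boldsymbol{D}_k\bar{\boldsymbol{\delta}}_k^j+2A^k\boldsymbol{x}_0+2\boldsymbol{B}_k\bar{\boldsymbol{u}}_k\big)^TQ\boldsymbol{D}_k\bar{\boldsymbol{\delta}}_k^j,$$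 $$s(j)+z\ge\sum_{k=0}^{N-1}\big(\boldsymbol{D}_k\bar{\boldsymbol{\delta}}_k^j+2A^k\boldsymbol{x}_0+2\boldsymbol{B}_k\bar{\boldsymbol{u}}_k\big)^TQ\boldsymbol{D}_k\bar{\boldsymbol{\delta}}_k^j,$$ $$s(j)\ge0.$$
   Context: Batch notation: $\boldsymbol{B}_k=[A^{k-1}B\ \ A^{k-2}B\ \cdots\ B]$, $\boldsymbol{D}_k=[A^{k-1}D\ \ A^{k-2}D\ \cdots\ D]$, $\bar{\boldsymbol{u}}_k=(\boldsymbol{u}_0^T,\dots,\boldsymbol{u}_{k-1}^T)^T$, $\bar{\boldsymbol{\delta}}_k=(\boldsymbol{\delta}_0^T,\dots,\boldsymbol{\delta}_{k-1}^T)^T$, so $\boldsymbol{x}_k=A^k\boldsymbol{x}_0+\boldsymbol{B}_k\bar{\boldsymbol{u}}_k+\boldsymbol{D}_k\bar{\boldsymbol{\delta}}_k$ (for $k=0$ the terms $\boldsymbol{B}_0\bar{\boldsymbol{u}}_0$, $\boldsymbol{D}_0\bar{\boldsymbol{\delta}}_0$ are $0$). The nominal state is $\tilde{\boldsymbol{x}}_k=A^k\boldsymbol{x}_0+\boldsymbol{B}_k\bar{\boldsymbol{u}}_k$. The outcomes of the joint noise $\bar{\boldsymbol{\delta}}_N$ are indexed by $j\in\{1,\dots,J^N\}$ with joint (nominal) probability mass function $p_N$; $\bar{\boldsymbol{\delta}}_k^j$ denotes the first $k$ noise blocks of outcome $j$. TVD risk: for a random variable $C$ on a finite set of $M$ outcomes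 with nominal probability mass function $\pi$ and values $C^j$, $\mathrm{TVD}_{1-\alpha}(C)=\sup\{\sum_{j=1}^M q(j)C^j : q\in\mathbb{R}^M,\ q\ge0,\ \sum_j q(j)=1,\ \tfrac12\sum_j|q(j)-\pi(j)|\le\alpha\}$. In the claim it is taken with $M=J^N$ and $\pi=p_N$. *)

(* Defs.v *)
From HB Require Import structures.
From mathcomp Require Import all_boot all_order all_algebra.
From mathcomp Require Import boolp classical_sets reals.

Set Implicit Arguments.
Unset Strict Implicit.
Unset Printing Implicit Defensive.

Import Order.TTheory GRing.Theory Num.Theory.
Local Open Scope classical_set_scope.
Local Open Scope ring_scope.

Definition is_pmf (R : realType) (M : nat) (q : 'I_M -> R) : Prop :=
  (forall j, 0 <= q j) /\ \sum_(j < M) q j = 1.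

(* [tvd_risk alpha pi C] is the risk measure written TVD_{1-alpha}(C): the
   argument is the radius alpha of the ball, not the level 1 - alpha.  For a
   pmf pi and 0 <= alpha the set below is nonempty and bounded, so that [sup]
   is a genuine supremum. *)
Definition tvd_risk (R : realType) (M : nat) (alpha : R) (pi C : 'I_M -> R) : R :=
  sup [set \sum_(j < M) q j * C j | q in
        [set q : 'I_M -> R |
          is_pmf q /\ 2^-1 * (\sum_(j < M) `|q j - pi j|) <= alpha]].

(* [v] is the minimum of [S]: the value is attained. *)
Definition is_min (R : realType) (S : set R) (v : R) : Prop :=
  S v /\ lbound S v.

Definition psd (R : realType) (n : nat) (Q : 'M[R]_n) : Prop :=
  Q \is symmetricmx /\ forall v : 'cV[R]_n, 0 <= (v^T *m Q *m v) 0 0.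

Definition stage_cost (R : realType) (nx nu : nat) (Q : 'M[R]_nx) (Ru : 'M[R]_nu)
    (x : 'cV[R]_nx) (u : 'cV[R]_nu) : R :=
  (x^T *m Q *m x) 0 0 + (u^T *m Ru *m u) 0 0.

(* States are indexed by 0, ..., N; inputs [u] and noise [w] by 0, ..., N-1. *)
Definition trajectory (R : realType) (N nx nu nd : nat)
    (A : 'M[R]_nx) (B : 'M[R]_(nx, nu)) (D : 'M[R]_(nx, nd)) (x0 : 'cV[R]_nx)
    (u : 'I_N -> 'cV[R]_nu) (w : 'I_N -> 'cV[R]_nd)
    (x : 'I_N.+1 -> 'cV[R]_nx) : Prop :=
  x ord0 = x0 /\
  forall k : 'I_N,
    x (lift ord0 k) = A *m x (widen_ord (leqnSn N) k) + B *m u k + D *m w k.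

(* The block row [A^(k-1) G, A^(k-2) G, ..., G]; it has no columns for k = 0. *)
Definition batch_mx (R : realType) (nx m : nat) (A : 'M[R]_nx) (G : 'M[R]_(nx, m))
    (k : nat) : 'M[R]_(nx, \sum_(i < k) m) :=
  \mxrow_(i < k) (A ^+ (k - i.+1) *m G).

(* The block column (v_0^T, ..., v_(k-1)^T)^T. *)
Definition batch_vec (R : realType) (N m : nat) (v : 'I_N -> 'cV[R]_m)
    (k : 'I_N) : 'cV[R]_(\sum_(i < k) m) :=
  \mxcol_(i < k) v (widen_ord (ltnW (ltn_ord k)) i).

Definition nominal_state (R : realType) (N nx nu : nat)
    (A : 'M[R]_nx) (B : 'M[R]_(nx, nu)) (x0 : 'cV[R]_nx)
    (u : 'I_N -> 'cV[R]_nu) (k : 'I_N) : 'cV[R]_nx :=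
  A ^+ k *m x0 + batch_mx A B k *m batch_vec u k.

(* The right-hand side of the constraints, for one noise realization [w]:
   sum_k (D_k w_k + 2 A^k x0 + 2 B_k u_k)^T Q D_k w_k in batch notation. *)
Definition cost_deviation (R : realType) (N nx nu nd : nat)
    (A : 'M[R]_nx) (B : 'M[R]_(nx, nu)) (D : 'M[R]_(nx, nd)) (Q : 'M[R]_nx)
    (x0 : 'cV[R]_nx) (u : 'I_N -> 'cV[R]_nu) (w : 'I_N -> 'cV[R]_nd) : R :=
  \sum_(k < N)
    ((batch_mx A D k *m batch_vec w k
      + 2 *: (A ^+ k *m x0)
      + 2 *: (batch_mx A B k *m batch_vec u k))^T
     *m Q *m (batch_mx A D k *m batch_vec w k)) 0 0.

(* Joint pmf of N i.i.d. draws from [p], the J^N joint outcomes being numbered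
   through [e]: under outcome j the k-th draw is [e j k]. *)
Definition joint_pmf (R : realType) (N J : nat) (p : 'I_J -> R)
    (e : 'I_(J ^ N)%N -> {ffun 'I_N -> 'I_J}) (j : 'I_(J ^ N)%N) : R :=
  \prod_(k < N) p (e j k).

(* Main.v *)
(* By symmetry of Q the total cost under outcome j is the nominal cost plus the
   deviation c_j, so only the TVD risk of c matters.
   Weak duality: for q in the ball, min(q, pi) has mass at least 1 - alpha;
   scale it down to r of mass exactly 1 - alpha.  Bounding c by m on q - r and
   by s + z on r <= pi gives sum q c <= alpha m + (1 - alpha) z + sum pi s.
   Attainment: with z an alpha-quantile of c, let r consist of the upper
   1 - alpha of the mass of pi, and move the remaining mass alpha to a maximizer
   of c; then equality holds for m = max c and s = (c - z)^+. *)
Require Import Defs.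
From HB Require Import structures.
From mathcomp Require Import all_boot all_order all_algebra.
From mathcomp Require Import boolp classical_sets reals.
From mathcomp Require Import ring lra.

Set Implicit Arguments.
Unset Strict Implicit.
Unset Printing Implicit Defensive.

Import Order.TTheory GRing.Theory Num.Theory.
Local Open Scope classical_set_scope.
Local Open Scope ring_scope.

(** * Batch form of the dynamics, splitting of the cost, and the joint noise law *)

Lemma batch_mul (R : realType) (N nx m : nat) (A : 'M[R]_nx) (G : 'M[R]_(nx, m))
    (v : 'I_N -> 'cV[R]_m) (k : 'I_N) :
  batch_mx A G k *m batch_vec v k =
  \sum_(i < k) A ^+ (k - i.+1) *m G *m v (widen_ord (ltnW (ltn_ord k)) i).
Proof. by rewrite /batch_mx /batch_vec mul_mxrow_mxcol. Qed.

(** The newest block carries the power [A ^+ 0], and one factor [A] comes out of every older block.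
    This is the induction step for [trajectoryE]. *)
Lemma batch_mulS (R : realType) (N nx m : nat) (A : 'M[R]_nx) (G : 'M[R]_(nx, m))
    (v : 'I_N -> 'cV[R]_m) (k k' : 'I_N) : k' = k.+1 :> nat ->
  batch_mx A G k' *m batch_vec v k' =
  A *m (batch_mx A G k *m batch_vec v k) + G *m v k.
Proof.
rewrite !batch_mul; case: k' => k' hk' /= ek'; subst k'.
rewrite big_ord_recr /= subnn expr0 mul1mx mulmx_sumr.
congr (_ + G *m v _); last exact: val_inj.
apply: eq_bigr => i _; rewrite subSn // exprS !mulmxA.
by congr (_ *m _ *m v _); exact: val_inj.
Qed.

Lemma trajectoryE (R : realType) (N nx nu nd : nat)
    (A : 'M[R]_nx) (B : 'M[R]_(nx, nu)) (D : 'M[R]_(nx, nd)) (x0 : 'cV[R]_nx)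
    (u : 'I_N -> 'cV[R]_nu) (w : 'I_N -> 'cV[R]_nd) (x : 'I_N.+1 -> 'cV[R]_nx) :
  trajectory A B D x0 u w x ->
  forall k : 'I_N, x (widen_ord (leqnSn N) k) =
    nominal_state A B x0 u k + batch_mx A D k *m batch_vec w k.
Proof.
move=> [x_0 xS] [k hk]; elim: k hk => [|k IHk] hk.
  rewrite /nominal_state !batch_mul !big_ord0 expr0 mul1mx !addr0 -x_0.
  by congr x; exact: val_inj.
have hk' : (k < N)%N by exact: ltnW.
have -> : widen_ord (leqnSn N) (Ordinal hk) = lift ord0 (Ordinal hk').
  exact: val_inj.
rewrite xS IHk /nominal_state /=.
rewrite !(@batch_mulS _ _ _ _ _ _ _ (Ordinal hk') (Ordinal hk)) //=.
by rewrite exprS !mulmxDr -!mulmxA !addrA -!addrA; congr (_ + (_ + _)); rewrite addrCA.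
Qed.

Lemma stage_cost_add (R : realType) (nx nu : nat) (Q : 'M[R]_nx) (Ru : 'M[R]_nu)
    (x y : 'cV[R]_nx) (v : 'cV[R]_nu) : Q \is symmetricmx ->
  stage_cost Q Ru (x + y) v =
  stage_cost Q Ru x v + ((y + 2 *: x)^T *m Q *m y) 0 0.
Proof.
move=> Qsym; have cross : y^T *m Q *m x = x^T *m Q *m y.
  (* A 1 x 1 matrix equals its transpose, and transposing swaps [x] and [y] because [Q] is
     symmetric. *)
  rewrite [LHS]mx11_scalar -tr_scalar_mx -mx11_scalar !trmx_mul trmxK mulmxA.
  by have /eqP := Qsym; rewrite /= expr0 scale1r map_mx_id // => <-.
have trD (a b : 'cV[R]_nx) : (a + b)^T = a^T + b^T by rewrite linearD.
have trZ k (a : 'cV[R]_nx) : (k *: a)^T = k *: a^T by rewrite linearZ.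
rewrite /stage_cost !trD trZ !mulmxDl !mulmxDr cross.
rewrite -!scalemxAl !mxE; ring.
Qed.

Lemma total_costE (R : realType) (N nx nu nd : nat)
    (A : 'M[R]_nx) (B : 'M[R]_(nx, nu)) (D : 'M[R]_(nx, nd))
    (Q : 'M[R]_nx) (Ru : 'M[R]_nu) (x0 : 'cV[R]_nx)
    (u : 'I_N -> 'cV[R]_nu) (w : 'I_N -> 'cV[R]_nd) (x : 'I_N.+1 -> 'cV[R]_nx) :
  Q \is symmetricmx -> trajectory A B D x0 u w x ->
  \sum_(k < N) stage_cost Q Ru (x (widen_ord (leqnSn N) k)) (u k) =
  \sum_(k < N) stage_cost Q Ru (nominal_state A B x0 u k) (u k) +
  cost_deviation A B D Q x0 u w.
Proof.
move=> Qsym xP; rewrite /cost_deviation -big_split; apply: eq_bigr => k _ /=.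
by rewrite (trajectoryE xP) stage_cost_add // {2}/nominal_state scalerDr addrA.
Qed.

Lemma joint_pmf_is_pmf (R : realType) (N J : nat) (p : 'I_J -> R)
    (e : 'I_(J ^ N)%N -> {ffun 'I_N -> 'I_J}) :
  is_pmf p -> bijective e -> is_pmf (joint_pmf p e).
Proof.
move=> [p_ge0 p1] ebij; split=> [j|]; first exact: prodr_ge0.
(* Distributivity turns the sum over all draws into the N-th power of the total mass of [p]. *)
have <- : \sum_(f : {ffun 'I_N -> 'I_J}) \prod_(k < N) p (f k) = 1.
  by rewrite -(bigA_distr_bigA (fun _ => p)) p1 big1.
by rewrite [RHS](reindex e) //; exact: onW_bij.
Qed.

(** * Duality for the TVD risk on a finite set of outcomes *)

Lemma tvd_dual_ge (R : realType) (M : nat) (alpha : R) (pi c q s : 'I_M -> R)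
    (m z : R) :
  alpha < 1 -> is_pmf pi -> is_pmf q ->
  2^-1 * (\sum_(j < M) `|q j - pi j|) <= alpha ->
  (forall j, c j <= m) -> (forall j, c j <= s j + z) -> (forall j, 0 <= s j) ->
  \sum_(j < M) q j * c j <=
  alpha * m + (1 - alpha) * z + \sum_(j < M) pi j * s j.
Proof.
move=> alpha1 [pi_ge0 pi1] [q_ge0 q1] qball cm csz s_ge0.
pose mn j := Num.min (q j) (pi j).
have mn_ge0 j : 0 <= mn j by rewrite /mn le_min q_ge0 pi_ge0.
have mass : 1 - alpha <= \sum_j mn j.
  (* Pointwise, min(q, pi) = (q + pi - |q - pi|) / 2. *)
  have -> : \sum_j mn j = 1 - 2^-1 * (\sum_(j < M) `|q j - pi j|).
    have tot : 1 = 2^-1 * (\sum_j q j + \sum_j pi j) by rewrite q1 pi1; field.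
    rewrite [X in X - _]tot -mulrBr -big_split -sumrB mulr_sumr; apply: eq_bigr => j _ /=.
    by rewrite /mn; case: leP => qp; [rewrite ler0_norm | rewrite ger0_norm]; lra.
  by rewrite lerD2l lerN2.
pose l := (1 - alpha) / \sum_j mn j.
have mass_gt0 : 0 < \sum_j mn j by lra.
have l_ge0 : 0 <= l by rewrite divr_ge0 // ?ltW //; lra.
have l_le1 : l <= 1 by rewrite ler_pdivrMr // mul1r.
have r_le j : l * mn j <= mn j by rewrite ler_piMl.
have r_mass : \sum_j l * mn j = 1 - alpha by rewrite -mulr_sumr divfK // gt_eqF.
have -> : alpha * m + (1 - alpha) * z + \sum_(j < M) pi j * s j =
    \sum_j ((q j - l * mn j) * m + l * mn j * z + pi j * s j).
  by rewrite !big_split /= -!mulr_suml sumrB r_mass q1; ring.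
apply: ler_sum => j _.
have rq : l * mn j <= q j by rewrite (le_trans (r_le j)) // ge_min lexx.
have rpi : l * mn j <= pi j by rewrite (le_trans (r_le j)) // ge_min lexx orbT.
have r_ge0 : 0 <= l * mn j by rewrite mulr_ge0.
move: (l * mn j) rq rpi r_ge0 (cm j) (csz j) (s_ge0 j) => r rq rpi r_ge0 h1 h2 h3.
(* The gap between the two sides at [j] is exactly the sum of the next three nonnegative
   products. *)
have : 0 <= (q j - r) * (m - c j) by rewrite mulr_ge0 ?subr_ge0.
have : 0 <= r * (s j + z - c j) by rewrite mulr_ge0 ?subr_ge0.
have : 0 <= (pi j - r) * s j by rewrite mulr_ge0 ?subr_ge0.
lra.
Qed.

(** Take for [z] the largest value of [c] with mass at most [alpha] strictly below it. A minimum of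
    [c] qualifies, having no mass below it. *)
Lemma quantile_exists (R : realType) (M : nat) (alpha : R) (pi c : 'I_M -> R) :
  0 < alpha -> alpha < 1 -> is_pmf pi ->
  exists z : R, \sum_(j < M | c j < z) pi j <= alpha <= \sum_(j < M | c j <= z) pi j.
Proof.
move=> alpha0 alpha1 [pi_ge0 pi1].
(* Total mass 1 rules out an empty outcome set. *)
have [i0 _|i0] := pickP (xpredT : pred 'I_M); last first.
  by move: pi1; rewrite big_pred0 // => /eqP; rewrite eq_sym oner_eq0.
case: (@arg_minP _ _ _ i0 predT c isT) => jmin _ hmin.
have Pmin : \sum_(j < M | c j < c jmin) pi j <= alpha.
  by rewrite big_pred0 ?ltW // => j; apply/negbTE; rewrite -leNgt hmin.
case: (@arg_maxP _ _ _ jmin (fun i => \sum_(j < M | c j < c i) pi j <= alpha) c Pmin).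
move=> k hk kmax; exists (c k); rewrite hk /=.
have [i ik|none] := pickP [pred j | c k < c j]; last first.
  by rewrite (eq_bigl predT) ?pi1 ?ltW // => j; rewrite leNgt; exact/negbT/none.
(* [c i1] is the next value above [c k], so the mass strictly below it is the mass up to [c k]. Were
   that less than [alpha], [i1] would contradict the maximality of [k]. *)
case: (@arg_minP _ _ _ i (fun j => c k < c j) c ik) => i1 ki1 i1min.
rewrite leNgt; apply/negP => lt_alpha.
suff /kmax : \sum_(j < M | c j < c i1) pi j <= alpha.
  by rewrite /= leNgt ki1.
rewrite (eq_bigl (fun j => c j <= c k)) ?ltW // => j.
apply/idP/idP => [ji1|jk]; last exact: le_lt_trans ki1.
by rewrite leNgt; apply: contraL ji1 => /i1min; rewrite -leNgt.
Qed.

Lemma tvd_primal_attained (R : realType) (M : nat) (alpha : R) (pi c : 'I_M -> R) :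
  0 < alpha -> alpha < 1 -> is_pmf pi ->
  exists (q : 'I_M -> R) (jmax : 'I_M) (z : R),
    [/\ is_pmf q, 2^-1 * (\sum_(j < M) `|q j - pi j|) <= alpha,
        forall j, c j <= c jmax
      & \sum_(j < M) q j * c j =
        alpha * c jmax + (1 - alpha) * z +
        \sum_(j < M) pi j * Num.max 0 (c j - z)].
Proof.
move=> alpha0 alpha1 pipmf.
have [z /andP[lo hi]] := quantile_exists c alpha0 alpha1 pipmf.
case: pipmf => pi_ge0 pi1.
have [i0 _|i0] := pickP (xpredT : pred 'I_M); last first.
  by move: pi1; rewrite big_pred0 // => /eqP; rewrite eq_sym oner_eq0.
case: (@arg_maxP _ _ _ i0 predT c isT) => jmax _ hmax.
pose b := \sum_(j < M | c j == z) pi j.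
pose a := \sum_(j < M | c j < z) pi j.
have leE : \sum_(j < M | c j <= z) pi j = a + b.
  rewrite (bigID (fun j => c j < z)) /=; congr (_ + _); apply: eq_bigl => j.
    by apply: andb_idl => /ltW.
  by rewrite -leNgt eq_le.
have gtE : \sum_(j < M | z < c j) pi j = 1 - (a + b).
  rewrite -leE -pi1 [X in _ = X - _](bigID (fun j => c j <= z)) /= addrAC subrr add0r.
  by apply: eq_bigl => j; rewrite -ltNge.
(* The fraction of the atom at [z] to keep, so that the retained mass is 1 - alpha. If [b = 0] then
   [t = 0], and [a <= alpha <= a + b] forces [a = alpha], so [tb] still holds. *)
pose t := (a + b - alpha) / b.
have b_ge0 : 0 <= b by exact: sumr_ge0.
have ab : alpha <= a + b by rewrite -leE.
have a_le : a <= alpha by [].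
have t_ge0 : 0 <= t by rewrite divr_ge0 // subr_ge0.
have t_le1 : t <= 1.
  have [b0|b_neq0] := eqVneq b 0; first by rewrite /t b0 invr0 mulr0 ler01.
  by rewrite ler_pdivrMr ?mul1r ?lt0r ?b_neq0 //; lra.
have tb : t * b = a + b - alpha.
  have [b0|b_neq0] := eqVneq b 0; last by rewrite divfK.
  by rewrite b0 mulr0; lra.
pose r j := (if z < c j then 1 else if c j == z then t else 0) * pi j.
have r_ge0 j : 0 <= r j.
  by rewrite mulr_ge0 //; case: ifP => // _; case: ifP.
have r_le j : r j <= pi j.
  by rewrite ler_piMl //; case: ifP => // _; case: ifP.
have r_mass : \sum_j r j = 1 - alpha.
  have -> : 1 - alpha = \sum_(j < M | z < c j) pi j + t * b by rewrite gtE tb; ring.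
  rewrite (bigID (fun j => z < c j)) /=; congr (_ + _).
    by apply: eq_bigr => j zj; rewrite /r zj mul1r.
  rewrite (bigID (fun j => c j == z)) /= [X in _ + X]big1 ?addr0; last first.
    by move=> j /andP[/negbTE h1 /negbTE h2]; rewrite /r h1 h2 mul0r.
  rewrite mulr_sumr; apply: eq_big => [j|j /andP[/negbTE h1 h2]].
    by apply: andb_idl => /eqP ->; rewrite ltxx.
  by rewrite /r h1 h2.
pose dirac j : R := if j == jmax then alpha else 0.
have dirac_ge0 j : 0 <= dirac j by rewrite /dirac; case: ifP => // _; exact: ltW.
have dirac_sum f : \sum_j dirac j * f j = alpha * f jmax.
  rewrite (bigD1 jmax) //= /dirac eqxx big1 ?addr0 // => j /negbTE ->.
  exact: mul0r.
have dirac_mass : \sum_j dirac j = alpha.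
  rewrite -[RHS]mulr1 -(dirac_sum (fun=> 1)).
  by apply: eq_bigr => j _; rewrite mulr1.
exists (fun j => r j + dirac j), jmax, z; split.
- split=> [j|]; first exact: addr_ge0.
  by rewrite big_split /= r_mass dirac_mass subrK.
(* Since |r + dirac - pi| <= (pi - r) + dirac and both terms have mass [alpha], half the L1 distance
   is at most [alpha]. *)
- have -> : alpha = 2^-1 * \sum_j (pi j - r j + dirac j).
    by rewrite big_split /= sumrB pi1 r_mass dirac_mass; field.
  rewrite ler_pM2l ?invr_gt0 //; apply: ler_sum => j _.
  have := r_le j; have := dirac_ge0 j; rewrite ler_norml => h1 h2.
  by apply/andP; split; lra.
- by move=> j; exact: hmax.
- rewrite -r_mass mulr_suml -(dirac_sum c) -addrA -!big_split.
  (* Termwise, r c = r z + pi (c - z)^+: above [z], r = pi; below it, r = 0; at [z] the positive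
     part vanishes. *)
  apply: eq_bigr => j _ /=; rewrite /r.
  case: ltgtP => [zj|jz|->]; rewrite ?ltxx ?eqxx.
  + by rewrite max_r ?subr_ge0 ?ltW //; ring.
  + rewrite max_l ?subr_le0 ?ltW //; ring.
  + by rewrite subrr maxxx; ring.
Qed.

Lemma pmf_sum_addl (R : realType) (M : nat) (k : R) (q c : 'I_M -> R) :
  is_pmf q ->
  \sum_(j < M) q j * (k + c j) = k + \sum_(j < M) q j * c j.
Proof.
move=> [_ q1]; rewrite -[X in X + _]mul1r -q1 mulr_suml -big_split.
by apply: eq_bigr => j _; rewrite mulrDr.
Qed.

Lemma tvd_risk_is_min (R : realType) (M : nat) (alpha k : R) (pi c : 'I_M -> R) :
  0 < alpha -> alpha < 1 -> is_pmf pi ->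
  is_min
    [set v : R | exists (m z : R) (s : 'I_M -> R),
      [/\ forall j, c j <= m, forall j, c j <= s j + z, forall j, 0 <= s j
        & v = k + alpha * m +
              (1 - alpha) * \sum_(j < M) pi j * (z + s j / (1 - alpha))]]
    (tvd_risk alpha pi (fun j => k + c j)).
Proof.
move=> alpha0 alpha1 pipmf.
have costE m z s : k + alpha * m +
      (1 - alpha) * \sum_(j < M) pi j * (z + s j / (1 - alpha)) =
    k + (alpha * m + (1 - alpha) * z + \sum_(j < M) pi j * s j).
  have -> : (1 - alpha) * \sum_(j < M) pi j * (z + s j / (1 - alpha)) =
      (1 - alpha) * z + \sum_(j < M) pi j * s j.
    have zE : z = \sum_(j < M) pi j * z.
      by case: pipmf => _ pi1; rewrite -mulr_suml pi1 mul1r.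
    rewrite [X in _ = _ * X + _]zE !mulr_sumr -big_split; apply: eq_bigr => j _ /=; field.
    by rewrite subr_eq0 gt_eqF.
  by rewrite !addrA.
have [q [jmax [z [qpmf qball cmax qE]]]] := tvd_primal_attained c alpha0 alpha1 pipmf.
(* Used three times: it makes the supremum finite, bounds it by the optimal dual value, and shows
   that no feasible point does better. *)
have upper m z' s : (forall j, c j <= m) -> (forall j, c j <= s j + z') ->
    (forall j, 0 <= s j) ->
    ubound [set \sum_(j < M) q j * (k + c j) | q in
        [set q : 'I_M -> R |
          is_pmf q /\ 2^-1 * (\sum_(j < M) `|q j - pi j|) <= alpha]]
      (k + (alpha * m + (1 - alpha) * z' + \sum_(j < M) pi j * s j)).
  move=> cm csz s_ge0 _ [q' [q'pmf q'ball] <-].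
  by rewrite pmf_sum_addl // lerD2l; exact: tvd_dual_ge.
pose s j := Num.max 0 (c j - z).
have csz j : c j <= s j + z by rewrite -lerBlDr le_max lexx orbT.
have s_ge0 j : 0 <= s j by rewrite le_max lexx.
have qin : [set \sum_(j < M) q j * (k + c j) | q in
        [set q : 'I_M -> R |
          is_pmf q /\ 2^-1 * (\sum_(j < M) `|q j - pi j|) <= alpha]]
    (\sum_(j < M) q j * (k + c j)) by exists q.
split.
(* The supremum is at least the value at [q], which equals the dual bound for this triple, so both
   agree. *)
- exists (c jmax), z, s; split => //; rewrite costE -qE -pmf_sum_addl //.
  apply/le_anti/andP; split.
    apply: ge_sup; first by eexists; exact: qin.
    by rewrite pmf_sum_addl // qE; exact: upper.
  by apply: ub_le_sup qin; eexists; exact: (upper _ _ _ cmax csz s_ge0).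
- move=> _ [m [z' [s' [cm csz' s'_ge0 ->]]]]; rewrite costE.
  by apply: ge_sup; [eexists; exact: qin | exact: upper].
Qed.

Theorem lemma3 (R : realType) (N nx nu nd J : nat) (hN : (1 <= N)%N)
    (alpha : R) (halpha0 : 0 < alpha) (halpha1 : alpha < 1)
    (A : 'M[R]_nx) (B : 'M[R]_(nx, nu)) (D : 'M[R]_(nx, nd))
    (Q : 'M[R]_nx) (Ru : 'M[R]_nu) (hQ : psd Q) (hRu : psd Ru)
    (x0 : 'cV[R]_nx) (u : 'I_N -> 'cV[R]_nu)
    (* values and pmf of the one-step noise *)
    (d : 'I_J -> 'cV[R]_nd) (p : 'I_J -> R) (hp : is_pmf p)
    (* numbering of the joint noise outcomes *)
    (e : 'I_(J ^ N)%N -> {ffun 'I_N -> 'I_J}) (he : bijective e)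
    (delta : 'I_(J ^ N)%N -> 'I_N -> 'cV[R]_nd)
    (hdelta : forall j k, delta j k = d (e j k))
    (x : 'I_(J ^ N)%N -> 'I_N.+1 -> 'cV[R]_nx)
    (hx : forall j, trajectory A B D x0 u (delta j) (x j)) :
  is_min
    [set v : R | exists (m z : R) (s : 'I_(J ^ N)%N -> R),
      [/\ forall j, cost_deviation A B D Q x0 u (delta j) <= m,
          forall j, cost_deviation A B D Q x0 u (delta j) <= s j + z,
          forall j, 0 <= s j
        & v = \sum_(k < N) stage_cost Q Ru (nominal_state A B x0 u k) (u k)
              + alpha * m
              + (1 - alpha) *
                \sum_(j < (J ^ N)%N) joint_pmf p e j * (z + s j / (1 - alpha))]]
    (tvd_risk alpha (joint_pmf p e)
      (fun j => \sum_(k < N)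
                  stage_cost Q Ru (x j (widen_ord (leqnSn N) k)) (u k))).
Proof.
have -> : (fun j => \sum_(k < N)
      stage_cost Q Ru (x j (widen_ord (leqnSn N) k)) (u k)) =
    (fun j => \sum_(k < N) stage_cost Q Ru (nominal_state A B x0 u k) (u k) +
      cost_deviation A B D Q x0 u (delta j)).
  by apply: funext => j; apply: total_costE (hx j); case: hQ.
exact: tvd_risk_is_min halpha0 halpha1 (joint_pmf_is_pmf hp he).
Qed.
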